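(* Let $\mathfrak{g}$ be a complex semisimple Lie algebra, let $V$ be a finite dimensional complex $\mathfrak{g}$-module, and let $\mathfrak{n}=V\oplus\mathfrak{g}$ (direct sum of complex vector spaces). Let $B_1^*$ and $B_2^*$ be two nondegenerate symmetric complex bilinear forms on $\mathfrak{n}$ that are both admissible (properties 1), 2), 3) of the context), and let $[\,,]_1$ and $[\,,]_2$ be the corresponding 2-step nilpotent Lie algebra structures on $\mathfrak{n}$. Then the Lie algebras $\{\mathfrak{n},[\,,]_1\}$ and $\{\mathfrak{n},[\,,]_2\}$ are isomorphic.
   Context: A nondegenerate symmetric complex bilinear form $B^*$ on $\mathfrak{n}=V\oplus\mathfrak{g}$ is called admissible here if: 1) $V$ and $\mathfrak{g}$ are orthogonal relative to $B^*$; 2) $B^*(Xv,v')+B^*(v,Xv')=0$ for all $v,v'\in V$ and all $X\in\mathfrak{g}$; 3) $B^*(\mathrm{ad}\,X(Y),Z)+B^*(Y,\mathrm{ad}\,X(Z))=0$ for all $X,Y,Z\in\mathfrak{g}$ (here $\mathrm{ad}$ is the adjoint representation of the semisimple Lie algebra $\mathfrak{g}$). The corresponding Lie algebra structure $[\,,]$ on $\mathfrak{n}$ is the complex Lie algebra structure for which $\mathfrak{g}$ lies in the center of $\mathfrak{n}$, $[\mathfrak{n},\mathfrak{n}]\subseteq\mathfrak{g}$, and $B^*([v,v'],Z)=B^*(Zv,v')$ for all $v,v'\in V$ and all $Z\in\mathfrak{g}$. *)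

(* Defs.v *)
From HB Require Import structures.
From mathcomp Require Import all_boot all_order all_algebra.
From mathcomp Require Export sesquilinear complex reals.

Set Implicit Arguments.
Unset Strict Implicit.
Unset Printing Implicit Defensive.

Import GRing.Theory.

Local Open Scope ring_scope.

(* Lie algebra structures are unbundled from their carrier, because several of
   them are considered on the same vector space. *)
Record lieStructure (K : fieldType) (L : vectType K) := LieStructure {
  lie_bracket :> {bilinear L -> L -> L};
  lie_alternating : forall x : L, lie_bracket x x = 0;
  lie_jacobi : forall x y z : L,
    lie_bracket x (lie_bracket y z) + lie_bracket y (lie_bracket z x)
      + lie_bracket z (lie_bracket x y) = 0
}.

Section LieAlgebra.

Variables (K : fieldType) (L : vectType K) (br : lieStructure L).

Definition lie_ideal (I : {vspace L}) : Prop :=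
  forall x y : L, y \in I -> br x y \in I.

(* By bilinearity, the brackets of basis vectors span all of [I, J]. *)
Definition lie_prod (I J : {vspace L}) : {vspace L} :=
  <<[seq br x y | x <- vbasis I, y <- vbasis J]>>%VS.

Definition derived_series (I : {vspace L}) (n : nat) : {vspace L} :=
  iter n (fun J => lie_prod J J) I.

Definition lie_solvable (I : {vspace L}) : Prop :=
  exists n : nat, derived_series I n = 0%VS.

(* The radical (the largest solvable ideal) vanishes. *)
Definition lie_semisimple : Prop :=
  forall I : {vspace L}, lie_ideal I -> lie_solvable I -> I = 0%VS.

End LieAlgebra.

Definition lie_isomorphic (K : fieldType) (L1 L2 : vectType K)
    (br1 : lieStructure L1) (br2 : lieStructure L2) : Prop :=
  exists f : {linear L1 -> L2},
    bijective f /\ forall x y : L1, f (br1 x y) = br2 (f x) (f y).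

Record lieModule (K : fieldType) (g : vectType K) (br : lieStructure g)
    (V : vectType K) := LieModule {
  lie_act :> {bilinear g -> V -> V};
  lie_actM : forall (X Y : g) (v : V),
    lie_act (br X Y) v = lie_act X (lie_act Y v) - lie_act Y (lie_act X v)
}.

Section TwoStep.

Variables (K : fieldType) (g : vectType K) (br : lieStructure g).
Variables (V : vectType K) (act : lieModule br V).

Definition inV (v : V) : V * g := (v, 0).
Definition inG (X : g) : V * g := (0, X).

Record admissible (B : {symmetric (V * g)%type}) : Prop := Admissible {
  admissible_nondegenerate : nondegenerate B;
  admissible_orthogonal : forall (v : V) (X : g), B (inV v) (inG X) = 0;
  admissible_act : forall (X : g) (v v' : V),
    B (inV (act X v)) (inV v') + B (inV v) (inV (act X v')) = 0;
  admissible_ad : forall X Y Z : g,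
    B (inG (br X Y)) (inG Z) + B (inG Y) (inG (br X Z)) = 0
}.

Record corresponding (B : {symmetric (V * g)%type})
    (N : lieStructure (V * g)%type) : Prop := Corresponding {
  corresponding_center : forall (Z : g) (x : V * g), N (inG Z) x = 0;
  corresponding_derived : forall x y : V * g, exists Z : g, N x y = inG Z;
  corresponding_form : forall (v v' : V) (Z : g),
    B (N (inV v) (inV v')) (inG Z) = B (inV (act Z v)) (inV v')
}.

End TwoStep.

(* Main.v *)
Require Import Defs.
From HB Require Import structures.
From mathcomp Require Import all_boot all_order all_algebra.
From mathcomp Require Import sesquilinear complex reals ring.

Set Implicit Arguments.
Unset Strict Implicit.
Unset Printing Implicit Defensive.

Import GRing.Theory Num.Theory.
Import passmx.

Local Open Scope ring_scope.

(** Restrict the two forms to the summands: [b1], [b2] on [V] and [c1], [c2] on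
    [g].  Since the summands are orthogonal, these restrictions are again
    symmetric and nondegenerate.

    On [V], write [b1 u v = b2 (S u) v].  The operator [S] is invertible,
    self-adjoint for [b2], and commutes with [g], because every element of [g]
    is skew for both forms.  Over an algebraically closed field of
    characteristic other than 2, an invertible operator has a square root [P]
    that is a polynomial in it ([poly_sqrt_mod], [unitmx_sqrt]).  Such a [P] is
    also self-adjoint for [b2] and commutes with [g], so that
    [b1 u v = b2 (P u) (P v)] ([congruent_forms]).

    On [g], it is enough to write [c1 X Y = c2 (T X) Y] with [T] invertible
    ([form_transfer]).  Then, for [u], [v] in [V] and [Z] in [g],

      [c2 (T [u, v]_1) Z = c1 [u, v]_1 Z = b1 (Z u) v = b2 (P (Z u)) (P v)
                         = b2 (Z (P u)) (P v) = c2 [P u, P v]_2 Z],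

    hence [T [u, v]_1 = [P u, P v]_2]: the map [(v, X) |-> (P v, T X)] is the
    isomorphism.  Only [V] calls for a square root: [T] need not carry [c1] to
    [c2], it only has to turn one bracket into the other. *)

(** The square root is built one root [a] of the modulus at a time.  If the
    product [q] of the factors treated so far satisfies [p ^+ 2 - 'X = h * q],
    then [p + t *: q] squares to ['X] modulo [('X - a) * q] exactly when [t]
    solves [h(a) + 2 p(a) t + q(a) t ^+ 2 = 0].  This equation in [t] has a
    solution unless [q(a) = p(a) = 0], which would force [a = 0]. *)
Lemma poly_sqrt_mod (F : closedFieldType) (rs : seq F) :
  2%:R != 0 :> F -> 0 \notin rs ->
  exists p : {poly F}, \prod_(a <- rs) ('X - a%:P) %| p ^+ 2 - 'X.
Proof.
move=> two_neq0; elim: rs => [_|a rs IHrs].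
  by exists 0; rewrite big_nil dvd1p.
rewrite inE negb_or eq_sym => /andP[a_neq0 /IHrs[p]].
set q := \prod_(_ <- _) _ => /dvdpP[h def_h].
pose r : {poly F} := q.[a] *: 'X^2 + (2%:R * p.[a]) *: 'X + h.[a]%:P.
have [t rt0] : exists t, root r t.
  apply/closed_rootP/negP => /eqP size_r.
  have qa0 : q.[a] = 0.
    have : r`_2 = 0 by rewrite nth_default ?size_r.
    rewrite /r !(coefD, coefZ, coefXn, coefX, coefC) /=.
    by rewrite !(mulr1, mulr0, addr0).
  have pa0 : p.[a] = 0.
    have : r`_1 = 0 by rewrite nth_default ?size_r.
    rewrite /r !(coefD, coefZ, coefXn, coefX, coefC) /=.
    rewrite !(mulr1, mulr0, addr0, add0r).
    by move/eqP; rewrite mulf_eq0 (negPf two_neq0) => /eqP.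
  have := congr1 (horner^~ a) def_h.
  rewrite !hornerE /= qa0 pa0 mulr0 expr0n /= sub0r => /eqP.
  by rewrite oppr_eq0 (negPf a_neq0).
exists (p + t *: q); rewrite big_cons -/q.
have -> : (p + t *: q) ^+ 2 - 'X
          = (h + (2%:R * t) *: p + (t ^+ 2) *: q) * q.
  rewrite -!mul_polyC polyCM polyC_exp polyC_natr 2!(mulrDl _ _ q) -def_h.
  by ring.
rewrite dvdp_mul // dvdp_XsubCl /root.
move: rt0; rewrite /root /r !hornerE => /eqP rt0.
by apply/eqP; rewrite -[RHS]rt0 /=; ring.
Qed.

(** By Cayley-Hamilton, a square root of ['X] modulo the characteristic
    polynomial of [S], evaluated at [S], is a square root of [S].  The two
    transfer properties record what is used of its being a polynomial in [S]:
    for [G] the Gram matrix of a form, [S *m G = G *m S^T] says that [S] is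
    self-adjoint. *)
Lemma unitmx_sqrt (F : closedFieldType) (n : nat) (S : 'M[F]_n) :
  2%:R != 0 :> F -> S \in unitmx ->
  exists P : 'M[F]_n,
    [/\ P *m P = S,
        forall A : 'M_n, S *m A = A *m S -> P *m A = A *m P
      & forall G : 'M_n, S *m G = G *m S^T -> P *m G = G *m P^T].
Proof.
move=> two_neq0; case: n S => [|n] S.
  (* Polynomials are evaluated at matrices of positive size only. *)
  by exists 1%:M; split=> *; apply: flatmx0_eq || apply/matrixP=> -[].
move=> Su; have [rs] := closed_field_poly_normal (char_poly S).
rewrite (monicP (char_poly_monic S)) scale1r => defS.
have rs_neq0 : 0 \notin rs.
  rewrite -root_prod_XsubC -defS /root horner_coef0 char_poly_det mulf_eq0.
  by rewrite signr_eq0 /= -unitfE -unitmxE.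
have [p] := poly_sqrt_mod two_neq0 rs_neq0.
rewrite -defS => /dvdpP[h def_h].
have sqP : horner_mx S p *m horner_mx S p = S.
  apply/eqP; rewrite -subr_eq0 -{3}(horner_mx_X S).
  rewrite -[_ *m _]/(_ * _) -rmorphM -rmorphB /=.
  by rewrite -expr2 def_h rmorphM /= Cayley_Hamilton mulr0.
exists (horner_mx S p); split=> // [A SA|G SG]; first exact: comm_horner_mx.
elim/poly_ind: p {def_h sqP} => [|p c IHp].
  by rewrite !rmorph0 /= trmx0 mulmx0 mul0mx.
rewrite rmorphD rmorphM /= horner_mx_X horner_mx_C -[_ * S]/(_ *m S).
rewrite linearD /= trmx_mul tr_scalar_mx mulmxDl mulmxDr.
rewrite mul_scalar_mx mul_mx_scalar; congr (_ + _).
rewrite mulmxA -SG -!mulmxA -IHp !mulmxA; congr (_ *m _).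
exact: comm_horner_mx.
Qed.

Lemma mxform_inj (K : fieldType) (n : nat) (A B : 'M[K]_n) :
  (forall r s : 'rV_n, (r *m A *m s^T) 0 0 = (r *m B *m s^T) 0 0) -> A = B.
Proof.
move=> eqAB; apply/matrixP => i j; have := eqAB 'e_i 'e_j.
by rewrite !trmx_delta -!rowE -!colE !mxE.
Qed.

Lemma inj_end_bij (K : fieldType) (U : vectType K) (f : 'End(U)) :
  injective f -> bijective f.
Proof.
by move/lker0P=> f0; exists f^-1%VF; [apply: lker0_lfunK | apply: lker0_lfunVK].
Qed.

Section Gram.

Variables (F : fieldType) (U : vectType F).

Local Notation e := (vbasis {:U}).

Definition gram (b : {biscalar U}) : 'M[F]_(\dim {:U}) :=
  \matrix_(i, j) b e`_i e`_j.

Definition left_nondegenerate (b : {biscalar U}) :=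
  forall u, (forall v, b u v = 0) -> u = 0.

Lemma gramE (b : {biscalar U}) (u v : U) :
  b u v = (rVof e u *m gram b *m (rVof e v)^T) 0 0.
Proof.
rewrite -[in LHS](rVofK (vbasisP _) u) -[in LHS](rVofK (vbasisP _) v) /vecof.
rewrite linear_sumr mxE; apply: eq_bigr => j _.
rewrite linearZr_LR /= mulrC !mxE linear_sumlz; congr (_ * _).
by apply: eq_bigr => i _; rewrite linearZl_LR !mxE.
Qed.

Lemma gram_unit (b : {biscalar U}) : left_nondegenerate b -> gram b \in unitmx.
Proof.
move=> b_nd; rewrite -row_free_unit; apply: inj_row_free => r r0.
rewrite -(vecofK (vbasisP {:U}) r) (b_nd (vecof _ r)) ?linear0 // => v.
by rewrite gramE vecofK ?vbasisP // r0 mul0mx mxE.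
Qed.

Lemma gram_tr (b : {biscalar U}) :
  (forall u v, b u v = b v u) -> (gram b)^T = gram b.
Proof. by move=> bC; apply/matrixP => i j; rewrite !mxE bC. Qed.

Lemma gram_skew (b : {biscalar U}) (A : 'End(U)) :
  (forall u v, b (A u) v + b u (A v) = 0) ->
  mxof e e A *m gram b = - (gram b *m (mxof e e A)^T).
Proof.
move=> skA; have eB := vbasisP {:U}; apply/mxform_inj => r s.
have := skA (vecof e r) (vecof e s).
rewrite !gramE !(rVof_app _ eB) !(vecofK eB) trmx_mul !mulmxA => /eqP.
by rewrite addr_eq0 => /eqP ->; rewrite mulmxN mulNmx [RHS]mxE !mulmxA.
Qed.

Lemma form_transfer (b1 b2 : {biscalar U}) :
  left_nondegenerate b1 -> left_nondegenerate b2 ->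
  exists T : 'End(U), bijective T /\ forall u v, b1 u v = b2 (T u) v.
Proof.
move=> b1_nd b2_nd; have eB := vbasisP {:U}.
pose T := hommx e e (gram b1 *m invmx (gram b2)).
have Tf u v : b1 u v = b2 (T u) v.
  by rewrite !gramE -rVof_mul // -!(mulmxA (rVof _ _)) mulmxKV ?gram_unit.
exists T; split=> //; apply: inj_end_bij => u v eq_uv.
apply/eqP; rewrite -subr_eq0; apply/eqP.
by apply: b1_nd => w; rewrite linearBl /= !Tf eq_uv subrr.
Qed.

End Gram.

(** With [G1] and [G2] the Gram matrices, [S = G1 *m G2^-1] is self-adjoint for
    [b2], so its square root [P] is too, and
    [G1 = P *m P *m G2 = P *m G2 *m P^T].  A matrix [M] skew for both forms
    commutes with [S], hence with [P]:
    [S M G2 = - S G2 M^T = - G1 M^T = M G1 = M S G2]. *)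
Lemma congruent_forms (F : closedFieldType) (U : vectType F)
    (b1 b2 : {biscalar U}) : 2%:R != 0 :> F ->
  (forall u v, b1 u v = b1 v u) -> (forall u v, b2 u v = b2 v u) ->
  left_nondegenerate b1 -> left_nondegenerate b2 ->
  exists P : 'End(U),
    [/\ bijective P, forall u v, b1 u v = b2 (P u) (P v)
      & forall A : 'End(U),
          (forall u v, b1 (A u) v + b1 u (A v) = 0) ->
          (forall u v, b2 (A u) v + b2 u (A v) = 0) ->
        forall u, P (A u) = A (P u)].
Proof.
move=> two_neq0 b1C b2C b1_nd b2_nd.
pose e := vbasis {:U}; have eB : basis_of {:U} e := vbasisP _.
have [G1u G2u] := (gram_unit b1_nd, gram_unit b2_nd).
have [S SG Su] : exists2 S, S *m gram b2 = gram b1 & S \in unitmx.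
  exists (gram b1 *m invmx (gram b2)); first by rewrite mulmxKV.
  by rewrite unitmx_mul G1u unitmx_inv.
have SG2T : S *m gram b2 = gram b2 *m S^T.
  by rewrite -[in RHS](gram_tr b2C) -trmx_mul SG gram_tr.
have [P [PP commP adjP]] := unitmx_sqrt two_neq0 Su.
have Pf u v : b1 u v = b2 (hommx e e P u) (hommx e e P v).
  rewrite !gramE -!rVof_mul // trmx_mul -SG -PP -!mulmxA (mulmxA P (gram b2)).
  by rewrite (adjP _ SG2T) !mulmxA.
exists (hommx e e P); split=> // [|A skA1 skA2 u].
  apply: inj_end_bij => u v eq_uv; apply/eqP; rewrite -subr_eq0; apply/eqP.
  by apply: b1_nd => w; rewrite linearBl /= !Pf eq_uv subrr.
pose M := mxof e e A.
have SM : S *m M = M *m S.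
  apply: (can_inj (mulmxK G2u)); rewrite /= -!mulmxA (gram_skew skA2) SG.
  by rewrite (gram_skew skA1) mulmxN mulmxA SG.
apply: (can_inj (rVofK eB)).
rewrite /= -(rVof_mul eB eB P (A u)) !(rVof_app _ eB A) -(rVof_mul eB eB P u).
by rewrite -!mulmxA commP.
Qed.

Section Pullback.

Variables (F : fieldType) (U W : vectType F) (h : {linear U -> W}).
Variable B : {symmetric W}.

Definition pullback (u v : U) : F := B (h u) (h v).

Lemma pullback_is_bilinear :
  bilinear_for (GRing.Scale.Law.clone _ _ *%R _)
               (GRing.Scale.Law.clone _ _ *%R _) pullback.
Proof.
split=> [u'|u] a x y; rewrite /pullback linearP; first by rewrite linearPl.
by rewrite linearPr.
Qed.

HB.instance Definition _ :=
  bilinear_isBilinear.Build F U U F _ _ pullback pullback_is_bilinear.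

End Pullback.

Section Summands.

Variables (K : fieldType) (g V : vectType K).

Lemma inV_is_linear : linear (@inV K g V).
Proof. by move=> a u v; rewrite /inV; congr pair; rewrite /= scaler0 addr0. Qed.

HB.instance Definition _ :=
  GRing.isLinear.Build K V (V * g)%type _ (@inV K g V) inV_is_linear.

Lemma inG_is_linear : linear (@inG K g V).
Proof. by move=> a u v; rewrite /inG; congr pair; rewrite /= scaler0 addr0. Qed.

HB.instance Definition _ :=
  GRing.isLinear.Build K g (V * g)%type _ (@inG K g V) inG_is_linear.

Lemma inVG (x : V * g) : x = inV g x.1 + inG V x.2.
Proof.
by case: x => v X; rewrite /inV /inG; congr pair; rewrite /= ?addr0 ?add0r.
Qed.

Variables (br : lieStructure g) (act : lieModule br V).
Variable B : {symmetric (V * g)%type}.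
Hypothesis admB : admissible act B.

Definition formV : {biscalar V} := pullback (@inV K g V) B.
Definition formG : {biscalar g} := pullback (@inG K g V) B.

Lemma symmetric_formC (x y : V * g) : B x y = B y x.
Proof. by rewrite hermC expr0 mul1r. Qed.

Lemma admissible_eq0 x : (forall y, B x y = 0) -> x = 0.
Proof.
move=> x0; apply/eqP; rewrite -memv0 -(eqP (admissible_nondegenerate admB)).
by apply/mem_orthovP.
Qed.

Lemma formV_nondegenerate : left_nondegenerate formV.
Proof.
move=> v v0; suff /(congr1 fst) : inV g v = 0 by [].
apply: admissible_eq0 => y; rewrite (inVG y) linearDr /=.
by rewrite (admissible_orthogonal admB) addr0; apply: v0.
Qed.

Lemma formG_nondegenerate : left_nondegenerate formG.
Proof.
move=> X X0; suff /(congr1 snd) : inG V X = 0 by [].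
apply: admissible_eq0 => y; rewrite (inVG y) linearDr /=.
by rewrite symmetric_formC (admissible_orthogonal admB) add0r; apply: X0.
Qed.

Variable N : lieStructure (V * g)%type.
Hypothesis corN : corresponding act B N.

Lemma correspondingE x y : N x y = N (inV g x.1) (inV g y.1).
Proof.
have NC z w : N z w = - N w z.
  apply/eqP; rewrite -addr_eq0; have := lie_alternating N (z + w).
  by rewrite linearDl !linearDr /= !lie_alternating addr0 add0r => ->.
rewrite {1}(inVG x) {1}(inVG y) linearDl /= (corresponding_center corN) addr0.
by rewrite linearDr /= (NC _ (inG V _)) (corresponding_center corN) oppr0 addr0.
Qed.

End Summands.

(** The isomorphism is [(v, X) |-> (P v, T X)], where [P] carries the first form
    on [V] to the second and commutes with the action, and [T] compares the two
    forms on [g].  It respects the brackets because [T [u, v]_1] and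
    [[P u, P v]_2] pair equally with every [Z] in [g] under the second form. *)
Lemma two_step_isomorphic (F : closedFieldType) (two_neq0 : 2%:R != 0 :> F)
    (g : vectType F) (br : lieStructure g)
    (V : vectType F) (act : lieModule br V)
    (B1 B2 : {symmetric (V * g)%type})
    (admB1 : admissible act B1) (admB2 : admissible act B2)
    (N1 N2 : lieStructure (V * g)%type)
    (corN1 : corresponding act B1 N1) (corN2 : corresponding act B2 N2) :
  lie_isomorphic N1 N2.
Proof.
have nV1 := formV_nondegenerate admB1; have nV2 := formV_nondegenerate admB2.
have nG1 := formG_nondegenerate admB1; have nG2 := formG_nondegenerate admB2.
have sV1 u v : formV B1 u v = formV B1 v u by exact: symmetric_formC.
have sV2 u v : formV B2 u v = formV B2 v u by exact: symmetric_formC.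
have [P [[P' PK P'K] Pf commP]] := congruent_forms two_neq0 sV1 sV2 nV1 nV2.
have [T [[T' TK T'K] Tf]] := form_transfer nG1 nG2.
have Pact X v : P (act X v) = act X (P v).
  have := commP (linfun (act X)) _ _ v; rewrite !lfunE /= => -> // u w.
    by rewrite !lfunE; apply: (admissible_act admB1).
  by rewrite !lfunE; apply: (admissible_act admB2).
pose f (x : V * g) := (P x.1, T x.2).
have f_lin : linear f.
  by move=> a x y; rewrite /f; congr pair; rewrite linearP.
pose fL := HB.pack_for {linear (V * g)%type -> (V * g)%type} f
  (GRing.isLinear.Build _ _ _ _ f f_lin).
exists fL; split=> [|x y].
  exists (fun x => (P' x.1, T' x.2)) => -[v X]; rewrite /= /f /=.
    by rewrite PK TK.
  by rewrite P'K T'K.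
rewrite [LHS]/= (correspondingE corN1) (correspondingE corN2) /=.
have [Z1 NZ1] := corresponding_derived corN1 (inV g x.1) (inV g y.1).
have [Z2 NZ2] := corresponding_derived corN2 (inV g (P x.1)) (inV g (P y.1)).
rewrite NZ1 NZ2 /f /inG /= linear0; congr pair.
apply/eqP; rewrite -subr_eq0; apply/eqP; apply: nG2 => Z.
apply/eqP; rewrite linearBl subr_eq0 /= -Tf; apply/eqP.
have := corresponding_form corN1 x.1 y.1 Z; rewrite NZ1 => E1.
have := corresponding_form corN2 (P x.1) (P y.1) Z; rewrite NZ2 => E2.
rewrite [LHS]E1 [RHS]E2 -Pact; exact: Pf.
Qed.

Theorem proposition2p3 (R : realType)
    (g : vectType R[i]) (br : lieStructure g) (ss : lie_semisimple br)
    (V : vectType R[i]) (act : lieModule br V)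
    (B1 B2 : {symmetric (V * g)%type}%R)
    (admB1 : admissible act B1) (admB2 : admissible act B2)
    (N1 N2 : lieStructure (V * g)%type)
    (corN1 : corresponding act B1 N1) (corN2 : corresponding act B2 N2) :
  lie_isomorphic N1 N2.
Proof.
apply: two_step_isomorphic admB1 admB2 _ _ corN1 corN2.
by rewrite pnatr_eq0.
Qed.
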